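(* If $\varphi$ is twice differentiable on its domain and $\varphi''$ is monotone, then $\operatorname{hgt}_{\psi^\star}(t)\le\dfrac{t^2}{2\varphi''(1)}$ for all $t\ge0$ (the right-hand side being read as $+\infty$ if $\varphi''(1)=0$). Equivalently, for such $\varphi$, $$D_\varphi(\mu\|\nu)\ge\frac{\varphi''(1)}{8}\,\mathrm{TV}(\mu,\nu)^2\qquad\text{for all }\mu,\nu\in\mathcal M^1.$$
   Context: $(\Omega,\mathcal F)$ is a measurable space with $\{\emptyset,\Omega\}\subsetneq\mathcal F$; $\mathcal M^1$ is the set of probability measures on it. $\mathrm{TV}(\mu,\nu)=\sup\{|\int g\,d\mu-\int g\,d\nu|: g:\Omega\to[-1,1]\text{ measurable}\}$ (values in $[0,2]$). Standing assumptions on $\varphi$: $\varphi:\mathbb R\to[0,+\infty]$ is convex, lower semicontinuous, $\varphi(1)=0$, $\varphi(x)=+\infty$ for $x<0$, and $\operatorname{dom}\varphi=\{\varphi<\infty\}$ contains a neighborhood of $1$. Differentiability of $\varphi$ on its domain is understood on the interior of $\operatorname{dom}\varphi$. $\varphi'(\infty)=\lim_{x\to\infty}\varphi(x)/x$. Set $\psi(x)=\varphi(x+1)$, $\psi^\star(y)=\sup_x\{xy-\psi(x)\}$. For probability measures with Lebesgue decomposition $\mu=\mu_c+\mu_s$ ($\mu_c\ll\nu$, $\mu_s\perp\nu$), $D_\varphi(\mu\|\nu)=\int\varphi(\frac{d\mu_c}{d\nu})d\nu+\mu_s(\Omega)\varphi'(\infty)$, with $0\cdot\infty=0$. Height-for-width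 function: $\operatorname{hgt}_{\psi^\star}(w)=\inf\{h\in[0,\infty]:\text{the Lebesgue measure of }\{x\in\mathbb R:\psi^\star(x)\le h\}\text{ is at least }w\}$ for $w\ge0$. *)

(* Defs.v *)
From HB Require Import structures.
From mathcomp Require Import all_boot all_order all_algebra.
From mathcomp Require Import all_classical all_reals all_analysis.

Set Implicit Arguments.
Unset Strict Implicit.
Unset Printing Implicit Defensive.

Import Order.TTheory GRing.Theory Num.Theory.
Import numFieldNormedType.Exports.

Local Open Scope classical_set_scope.
Local Open Scope ring_scope.
Local Open Scope ereal_scope.
Local Open Scope charge_scope.

Section generator.
Context {R : realType}.
Implicit Types phi psi : R -> \bar R.

Definition edom phi : set R := [set x | phi x < +oo].

(* With [phi >= 0], the right-hand side never meets [+oo - oo], and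
   [0 * +oo = 0] covers the endpoints [t = 0] and [t = 1]. *)
Definition econvex phi := forall (x y t : R), (0 <= t <= 1)%R ->
  phi (t * x + (1 - t) * y)%R <= t%:E * phi x + (1 - t)%:E * phi y.

Record divergence_generator phi : Prop := {
  generator_ge0 : forall x, 0 <= phi x;
  generator_convex : econvex phi;
  generator_lsc : lower_semicontinuous phi;
  generator1 : phi 1%R = 0;
  generator_neg : forall x, (x < 0)%R -> phi x = +oo;
  generator_nbhs1 : nbhs (1%R : R) (edom phi) }.

(* Derivatives of phi are those of the real function [fine \o phi], which
   agrees with phi on its effective domain; they are only meaningful on the
   interior of that domain, to which the conditions below are restricted. *)
Definition ederive phi (n : nat) : R -> R := derive1n n (fine \o phi).

Definition twice_differentiable phi := forall x, ((edom phi)°) x ->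
  derivable (ederive phi 0) x 1 /\ derivable (ederive phi 1) x 1.

Definition monotone_second_derivative phi :=
  (forall x y, ((edom phi)°) x -> ((edom phi)°) y -> (x <= y)%R ->
     (ederive phi 2 x <= ederive phi 2 y)%R) \/
  (forall x y, ((edom phi)°) x -> ((edom phi)°) y -> (x <= y)%R ->
     (ederive phi 2 y <= ederive phi 2 x)%R).

Definition slope_at_infty phi : \bar R :=
  lim ((phi x * (x^-1)%:E) @[x --> +oo%R]).

Definition shift1 phi : R -> \bar R := fun x => phi (x + 1)%R.

Definition conjugate psi : R -> \bar R := fun y =>
  ereal_sup [set (x * y)%:E - psi x | x in [set: R]].

Definition hgt (f : R -> \bar R) (w : R) : \bar R :=
  ereal_inf [set h : \bar R |
    0 <= h /\ w%:E <= lebesgue_measure [set x : R | f x <= h]].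

End generator.

Section divergence.
Context d (T : measurableType d) (R : realType).

Definition nontrivial_measurable :=
  exists A : set T, [/\ measurable A, A <> set0 & A <> setT].

(* Values in [0, 2]: twice the supremum of [|mu A - nu A|] over events [A]. *)
Definition TV (mu nu : probability T R) : \bar R :=
  ereal_sup [set `| \int[mu]_x (g x)%:E - \int[nu]_x (g x)%:E |
    | g in [set g : T -> R |
        measurable_fun [set: T] g /\ forall x, (-1 <= g x <= 1)%R]].

Definition mutually_singular (mu nu : set T -> \bar R) :=
  exists A, [/\ measurable A, mu (~` A) = 0 & nu A = 0].

Definition is_lebesgue_decomposition (mu nu muc mus : set T -> \bar R) :=
  [/\ forall A, measurable A -> mu A = muc A + mus A,
      muc `<< nu & mutually_singular mus nu].

Lemma lebesgue_decomposition_exists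
    (mu nu : {finite_measure set T -> \bar R}) :
  exists p : {finite_measure set T -> \bar R} *
             {finite_measure set T -> \bar R},
    is_lebesgue_decomposition mu nu p.1 p.2.
Proof.
pose S := [set mu A | A in [set A | measurable A /\ nu A = 0]].
have Sfin : ereal_sup S \is a fin_num.
  rewrite ge0_fin_numE; last first.
    by apply: ereal_sup_ubound; exists set0 => //; rewrite !measure0.
  apply: (@le_lt_trans _ _ (mu setT)); last exact: fin_num_fun_lty.
  apply: ge_ereal_sup => _ [A [mA _] <-].
  by apply: le_measure => //; rewrite inE.
have adh n : exists A : set T, [/\ measurable A, nu A = 0 &
    ereal_sup S - (n.+1%:R^-1)%:E < mu A].
  have n0 : (0 < n.+1%:R^-1 :> R)%R by rewrite invr_gt0.
  have [_ [A [mA nuA] <-] ltA] := ub_ereal_sup_adherent n0 Sfin.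
  by exists A; split.
pose A n := sval (cid (adh n)).
have AP n : [/\ measurable (A n), nu (A n) = 0 &
    ereal_sup S - (n.+1%:R^-1)%:E < mu (A n)] by rewrite /A; case: cid.
pose N := \bigcup_n A n.
have mN : measurable N by apply: bigcup_measurable => n _; have [] := AP n.
have nuN : nu N = 0.
  apply/negligibleP => //; apply: negligible_bigcup => n.
  by have [? ? _] := AP n; apply/negligibleP.
have muN : mu N = ereal_sup S.
  apply/eqP; rewrite eq_le; apply/andP; split.
    by apply: ereal_sup_ubound; exists N.
  apply/lee_addgt0Pr => e e0.
  have [n ne] : exists n, (n.+1%:R^-1 < e)%R.
    have [n _ /(_ n) nP] := near_infty_natSinv_lt (PosNum e0).
    by exists n; apply: nP => /=.
  have [mAn _] := AP n; rewrite lteBlDr// => /ltW /le_trans; apply.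
  apply: leeD; last by rewrite lee_fin ltW.
  by apply: le_measure; rewrite ?inE//; exact: bigcup_sup.
have fin (D : set T) : measurable D -> mu D < +oo.
  by move=> mD; rewrite ltey_eq fin_num_measure.
have mNC : measurable (~` N) by exact: measurableC.
pose muc : {finite_measure set T -> \bar R} := mfrestr mNC (fin _ mNC).
pose mus : {finite_measure set T -> \bar R} := mfrestr mN (fin _ mN).
exists (muc, mus); split => /=.
- move=> B mB; rewrite /muc /mus /= /mfrestr /mrestr -setDE.
  by rewrite -measureDI.
- apply/null_content_dominatesP => B mB nuB.
  rewrite /muc /= /mfrestr /mrestr -setDE.
  have mBN : measurable (B `\` N) by exact: measurableD.
  have : mu (B `\` N `|` N) <= mu N.
    rewrite [leRHS]muN; apply: ereal_sup_ubound; exists (B `\` N `|` N) => //.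
    split; first exact: measurableU.
    apply/negligibleP; first exact: measurableU.
    apply: negligibleU; last exact/negligibleP.
    by apply: (negligibleS (@subDsetl _ B N)); exact/negligibleP.
  rewrite measureU//; last by rewrite setDE -setIA setICl setI0.
  rewrite -[leRHS]add0e leeD2rE ?fin_num_measure// => le0.
  by apply/eqP; rewrite eq_le le0 measure_ge0.
- exists N; rewrite /mus /= /mfrestr /mrestr; split => //.
  by rewrite setICl measure0.
Qed.

(* The decomposition is unique on measurable sets, so the choice made here is
   immaterial. *)
Definition lebesgue_decomposition
    (mu nu : {finite_measure set T -> \bar R}) :=
  sval (cid (lebesgue_decomposition_exists mu nu)).

(* [fine] only drops the extended-real wrapper: the Radon-Nikodym derivative is
   everywhere finite. In [\bar R], [0 * +oo = 0]. *)
Definition phi_divergence (phi : R -> \bar R) (mu nu : probability T R) :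
    \bar R :=
  let: (muc, mus) := lebesgue_decomposition mu nu in
  \int[nu]_x phi (fine (('d (charge_of_finite_measure muc) '/d nu) x))
  + mus [set: T] * slope_at_infty phi.

End divergence.

(* Main.v *)
(* Taylor's formula of order 2 at [1], where [phi] and [phi'] vanish, turns the
   monotonicity of [phi''] into a one-sided quadratic bound: on one side of [1]
   (the right one if [phi''] increases, the left one if it decreases)
   [phi x >= c / 2 * (x - 1)^2] with [c = phi''(1)]. Boundary points of the
   domain are reached by convexity. Given this bound,
   - [psi^*(y) <= y^2 / (2 c)] for all [y >= 0] (resp. [y <= 0]), so that the
     sublevel set of [psi^*] at height [t^2 / (2 c)] contains an interval of
     length [t];
   - integrating an affine minorant of the bound against the density
     [d mu_c / d nu], with weights on the good side of [1], and optimizing its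
     slope gives the inequality between [D_phi] and [TV]. *)
Require Import Defs.
From mathcomp Require Import all_boot all_order all_algebra.
From mathcomp Require Import all_classical all_reals all_analysis.
From mathcomp Require Import measurable_realfun ring lra.

Import Order.TTheory GRing.Theory Num.Theory.
Import numFieldNormedType.Exports.

Local Open Scope classical_set_scope.
Local Open Scope ring_scope.

(** * Rolle's theorem and Taylor's formula of order 2, on either side of the base point *)

Lemma Rolle_between (R : realType) (f : R -> R) (a b : R) : a != b ->
  (forall x, Num.min a b <= x <= Num.max a b -> derivable f x 1) ->
  f a = f b -> exists2 c, Num.min a b < c < Num.max a b & derive1 f c = 0.
Proof.
wlog ab : a b / a < b.
  move=> h ab df fab.
  have [lab|lba|e] := ltgtP a b; last by rewrite e eqxx in ab.
  - by have := h a b lab ab df fab; rewrite min_l ?max_r ?ltW.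
  - rewrite eq_sym in ab; have := h b a lba ab _ (esym fab).
    rewrite minC maxC => /(_ df); by rewrite min_r ?max_l ?ltW.
rewrite min_l ?max_r ?ltW// => _ df fab.
have cf : {within `[a, b], continuous f}.
  by apply: derivable_within_continuous => x; rewrite in_itv; exact: df.
have df' x : x \in `]a, b[%R -> derivable f x 1.
  by rewrite in_itv /= => /andP[? ?]; apply: df; rewrite !ltW.
have [c cab /@derive_val fc] := Rolle ab df' cf fab.
by exists c; [rewrite in_itv in cab | rewrite derive1E].
Qed.

(** Rolle is used twice: [K] makes the remainder [g] vanish at [a] and [b], so [g'] vanishes at some
    [c] as well as at [a], and [g''] vanishes in between. *)
Lemma Taylor_Lagrange2 (R : realType) (f : R -> R) (a b : R) : a != b ->
  (forall x, Num.min a b <= x <= Num.max a b ->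
    derivable f x 1 /\ derivable (derive1 f) x 1) ->
  exists2 c, Num.min a b < c < Num.max a b &
    f b = f a + derive1 f a * (b - a)
          + derive1 (derive1 f) c / 2 * (b - a) ^+ 2.
Proof.
move=> ab df; have ba0 : b - a != 0 by rewrite subr_eq0 eq_sym.
pose K := (f b - f a - derive1 f a * (b - a)) / (b - a) ^+ 2.
pose g x := f x - f a - derive1 f a * (x - a) - K * (x - a) ^+ 2.
have dg x : Num.min a b <= x <= Num.max a b ->
    is_derive x 1 g (derive1 f x - derive1 f a - 2 * K * (x - a)).
  move=> /df[dfx _]; rewrite derive1E.
  have : is_derive x 1 f ('D_1 f x) by exact/derivableP.
  move=> fx; rewrite /g; apply: is_derive_eq.
  by rewrite /GRing.scale/=; ring.
have g' x : Num.min a b <= x <= Num.max a b ->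
    derive1 g x = derive1 f x - derive1 f a - 2 * K * (x - a).
  by move=> /dg gx; rewrite [LHS]derive1E; exact: derive_val.
have gab : g a = g b.
  by rewrite /g /K !subrr; field.
have [c cab gc] : exists2 c, Num.min a b < c < Num.max a b & derive1 g c = 0.
  by apply: Rolle_between => // x /dg[].
(* Off the segment [derive1 g] need not equal this formula, so its two-sided derivative at the
   endpoint [a] is out of reach; Rolle is applied to the formula instead. *)
pose h x := derive1 f x - derive1 f a - 2 * K * (x - a).
have ac : a != c.
  by apply: contraTneq cab => <-; rewrite gt_min lt_max ltxx/=; case: ltgtP.
have cab' : Num.min a b <= Num.min a c /\ Num.max a c <= Num.max a b.
  move: cab => /andP[/ltW c1 /ltW c2].
  by rewrite le_min ge_max c1 c2 ge_min le_max lexx.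
have dh x : Num.min a c <= x <= Num.max a c ->
    is_derive x 1 h (derive1 (derive1 f) x - 2 * K).
  move=> /andP[x1 x2].
  have [_ dfx] : derivable f x 1 /\ derivable (derive1 f) x 1.
    by apply: df; rewrite (le_trans cab'.1 x1) (le_trans x2 cab'.2).
  rewrite [in X in is_derive _ _ _ X]derive1E.
  have : is_derive x 1 (derive1 f) ('D_1 (derive1 f) x) by exact/derivableP.
  move=> fx; rewrite /h; apply: is_derive_eq.
  by rewrite /GRing.scale/=; ring.
have [e eac he] : exists2 e, Num.min a c < e < Num.max a c & derive1 h e = 0.
  apply: Rolle_between => //; first by move=> x /dh[].
  move: gc; rewrite g' ?/h ?subrr ?mulr0 ?subr0//.
  by move: cab => /andP[/ltW -> /ltW ->].
move: eac => /andP[e1 e2].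
exists e; first by rewrite (le_lt_trans cab'.1 e1) (lt_le_trans e2 cab'.2).
have -> : derive1 (derive1 f) e = 2 * K.
  have eac : Num.min a c <= e <= Num.max a c by rewrite !ltW.
  apply/eqP; rewrite -subr_eq0 -he [X in _ == X]derive1E.
  by apply/eqP/esym; have he' := dh _ eac; exact: derive_val.
by rewrite /K; field.
Qed.

Lemma le_of_sqr_scaled {R : realFieldType} {K F : R} : 0 <= F ->
  (forall t, 0 < t < 1 -> K * t ^+ 2 <= F) -> K <= F.
Proof.
move=> F0 hK; rewrite leNgt; apply/negP => FK.
have K0 : 0 < K by exact: le_lt_trans FK.
(* With this [t], [K t^2 >= 2 K t - K = (K + F) / 2 > F]. *)
pose t := 1 - (K - F) / (4 * K).
have tE : K * t = K - (K - F) / 4 by rewrite /t; field; rewrite gt_eqF.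
have t01 : 0 < t < 1.
  by apply/andP; split; rewrite -(ltr_pM2l K0) tE ?mulr0 ?mulr1; lra.
have := hK t t01; apply/negP; rewrite -ltNge.
have : 0 <= K * (t - 1) ^+ 2 by rewrite mulr_ge0 ?sqr_ge0// ltW.
have -> : K * (t - 1) ^+ 2 = K * t ^+ 2 - 2 * (K * t) + K by ring.
by rewrite tE; lra.
Qed.

(** * One-sided quadratic minorant of the generator *)

Section quadratic_bound.
Context {R : realType} (phi : R -> \bar R).
Hypothesis hphi : divergence_generator phi.

Lemma edom_fin_num x : edom phi x -> phi x \is a fin_num.
Proof. by move=> phix; rewrite ge0_fin_numE// (generator_ge0 hphi). Qed.

(** The domain is convex and contains a ball of radius [e] around 1. The homothety of center [x] and
    ratio [1 - t] maps that ball onto the ball of radius [(1 - t) e] around [1 + t (x - 1)]; [v] is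
    the preimage of [y]. *)
Lemma edom_interior_segment {x t : R} : edom phi x -> 0 <= t < 1 ->
  ((edom phi)°)%classic (1 + t * (x - 1)).
Proof.
move=> phix /andP[t0 t1]; have t1' : 0 < 1 - t by rewrite subr_gt0.
have /nbhs_ballP[e /= e0 be] := generator_nbhs1 hphi.
apply/nbhs_ballP; exists ((1 - t) * e) => /=; first exact: mulr_gt0.
move=> y; rewrite /ball/= => ye.
pose v := (y - t * x) / (1 - t).
have -> : y = t * x + (1 - t) * v by rewrite /v; field; lra.
have phiv : edom phi v.
  apply: be; rewrite /ball/=.
  have -> : 1 - v = (1 + t * (x - 1) - y) / (1 - t) by rewrite /v; field; lra.
  by rewrite normrM normfV (gtr0_norm t1') ltr_pdivrMr// [ltRHS]mulrC.
apply: le_lt_trans (generator_convex hphi _ _ _) _; first by rewrite t0 ltW.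
by rewrite -(fineK (edom_fin_num _ phix)) -(fineK (edom_fin_num _ phiv)) ltry.
Qed.

Lemma edom_interior1 : ((edom phi)°)%classic 1.
Proof. exact: generator_nbhs1 hphi. Qed.

Hypothesis hdiff : twice_differentiable phi.

(** Since [phi >= 0 = phi 1], the point 1 is a minimum, hence critical. *)
Lemma ederive1_at1 : ederive phi 1 1 = 0.
Proof.
have /nbhs_interior/nbhs_ballP[r /= r0 br] := edom_interior1.
have br' (t : R) : t \in `]1 - r, 1 + r[ -> ((edom phi)°)%classic t.
  rewrite in_itv/= => /andP[? ?]; apply: br; rewrite /ball/= ltr_norml.
  by apply/andP; split; lra.
rewrite /ederive/= derive1E; apply: derive_val.
apply: (@derive1_at_min _ _ (1 - r) (1 + r)).
- lra.
- by move=> t /br'/hdiff[].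
- by rewrite in_itv/=; apply/andP; split; lra.
- move=> t _ /=; rewrite (generator1 hphi)/=.
  exact: fine_ge0 (generator_ge0 hphi _).
Qed.

(** The terms of order 0 and 1 vanish at 1. Writing the intermediate point as [1 + t (x - 1)] treats
    both sides of 1 alike. *)
Lemma fine_generator_Taylor {x : R} : x != 1 ->
    (forall t : R, 0 <= t <= 1 -> ((edom phi)°)%classic (1 + t * (x - 1))) ->
  exists2 t, 0 < t < 1 &
    fine (phi x) = ederive phi 2 (1 + t * (x - 1)) / 2 * (x - 1) ^+ 2.
Proof.
move=> x1 hx; have x10 : x - 1 != 0 by rewrite subr_eq0.
have tE (y : R) : y = 1 + ((y - 1) / (x - 1)) * (x - 1) by field.
have x1' : 1 != x by rewrite eq_sym.
have [|c cx] := Taylor_Lagrange2 _ (fine \o phi) 1 x x1'.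
  move=> y yx; rewrite (tE y); apply: hdiff; apply: hx; move: yx.
  have [lt1x|ltx1|e1] := ltgtP 1 x; last by rewrite e1 eqxx in x1.
    by move=> /andP[? ?]; rewrite divr_ge0 ?ler_pdivrMr ?mul1r; lra.
  move=> /andP[? ?]; rewrite -[(y - 1) / _]mulrNN -invrN.
  by rewrite divr_ge0 ?ler_pdivrMr ?mul1r; lra.
rewrite /= (generator1 hphi) add0r.
have /= -> := ederive1_at1; rewrite mul0r add0r => ->.
exists ((c - 1) / (x - 1)); last by rewrite -tE.
move: cx; have [lt1x|ltx1|e1] := ltgtP 1 x; last by rewrite e1 eqxx in x1.
  by move=> /andP[? ?]; rewrite divr_gt0 ?ltr_pdivrMr ?mul1r; lra.
move=> /andP[? ?]; rewrite -[(c - 1) / _]mulrNN -invrN.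
by rewrite divr_gt0 ?ltr_pdivrMr ?mul1r; lra.
Qed.

(* Convexity gives [phi (1 + t (x - 1)) <= phi x] for [t < 1], which extends the
   bound from the interior of the domain to its endpoints. *)
Lemma generator_quadratic_ge {c x : R} :
    (forall t : R, 0 < t < 1 -> ((edom phi)°)%classic (1 + t * (x - 1)) ->
      c <= ederive phi 2 (1 + t * (x - 1))) ->
  ((c / 2 * (x - 1) ^+ 2)%:E <= phi x)%E.
Proof.
move=> hc; have [->|x1] := eqVneq x 1.
  by rewrite subrr expr0n mulr0; exact: generator_ge0 hphi _.
have [phix|phix] := ltP (phi x) +oo%E; last exact: le_trans (leey _) phix.
have F0 : 0 <= fine (phi x) by apply: fine_ge0; exact: generator_ge0 hphi _.
rewrite -(fineK (edom_fin_num _ phix)) lee_fin.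
apply: le_of_sqr_scaled => // t /andP[t0 t1].
pose y := 1 + t * (x - 1).
(* The Taylor point at ratio [u] towards [y] lies at ratio [u * t] towards [x], where [hc]
   applies. *)
have yE u : 1 + u * (y - 1) = 1 + u * t * (x - 1) by rewrite /y; ring.
have y1 : y != 1.
  by rewrite -subr_eq0 /y addrC addKr mulf_neq0 ?subr_eq0// gt_eqF.
have [|u /andP[u0 u1] phiy] := fine_generator_Taylor y1.
  move=> u /andP[u0 u1]; rewrite yE; apply: edom_interior_segment => //.
  by rewrite mulr_ge0 ?(ltW t0)//=; nra.
have ut : 0 < u * t < 1 by rewrite mulr_gt0//=; nra.
have phiyx : fine (phi y) <= fine (phi x).
  have t01 : 0 <= t <= 1 by rewrite !ltW.
  have := generator_convex hphi x 1 t01.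
  rewrite (generator1 hphi) mule0 adde0.
  have -> : t * x + (1 - t) * 1 = y by rewrite /y; ring.
  have phiyfin : phi y \is a fin_num.
    apply: edom_fin_num; apply: interior_subset.
    by apply: edom_interior_segment => //; rewrite ltW.
  rewrite -(fineK (edom_fin_num _ phix)) -(fineK phiyfin) -EFinM lee_fin/=.
  by move=> /le_trans; apply; nra.
apply: le_trans phiyx; rewrite phiy yE.
have -> : c / 2 * (x - 1) ^+ 2 * t ^+ 2 = c / 2 * (y - 1) ^+ 2.
  by rewrite /y; field.
rewrite ler_wpM2r ?sqr_ge0// ler_wpM2r//; apply: hc => //.
by apply: edom_interior_segment => //; case/andP: ut => /ltW -> ->.
Qed.

Hypothesis hmono : monotone_second_derivative phi.

Lemma generator_one_sided_quadratic :
  0 <= ederive phi 2 1 /\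
  ((forall x, 1 <= x ->
      ((ederive phi 2 1 / 2 * (x - 1) ^+ 2)%:E <= phi x)%E) \/
   (forall x, x <= 1 ->
      ((ederive phi 2 1 / 2 * (x - 1) ^+ 2)%:E <= phi x)%E)).
Proof.
have i1 := edom_interior1.
have /nbhs_interior/nbhs_ballP[r /= r0 br] := i1.
(* Taylor at [y] together with [phi y >= 0] yields a point between 1 and [y] where the second
   derivative is nonnegative. *)
have second_ge0 (y : R) : y != 1 -> `|1 - y| < r ->
    exists2 t : R, 0 < t < 1 & 0 <= ederive phi 2 (1 + t * (y - 1)) /\
    ((edom phi)°)%classic (1 + t * (y - 1)).
  move=> y1 yr; have iy : ((edom phi)°)%classic y by exact: br.
  have it (t : R) : 0 <= t <= 1 -> ((edom phi)°)%classic (1 + t * (y - 1)).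
    move=> /andP[t0]; rewrite le_eqVlt => /predU1P[->|t1].
      by rewrite mul1r addrC subrK.
    by apply: edom_interior_segment; [exact: interior_subset | rewrite t0].
  have [t t01 phiy] := fine_generator_Taylor y1 it.
  exists t => //; split; last by apply: it; case/andP: t01 => /ltW -> /ltW.
  have : 0 <= fine (phi y) by apply: fine_ge0; exact: generator_ge0 hphi _.
  by rewrite phiy pmulr_lge0 ?pmulr_lge0 ?exprn_even_gt0 ?subr_eq0//= invr_gt0.
case: hmono => hm.
- split.
    (* The sign of [phi''(1)] comes from the side opposite to the bound: when [phi''] increases, a
       nonnegative value to the left of 1 carries over to 1. *)
    have [||t /andP[t0 t1] [/le_trans + it]] := second_ge0 (1 - r / 2).
    + by rewrite -subr_eq0; lra.
    + by rewrite gtr0_norm; lra.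
    by apply; apply: hm => //; nra.
  left => x x1; apply: generator_quadratic_ge => t /andP[t0 t1] it.
  by apply: hm => //; nra.
- split.
    have [||t /andP[t0 t1] [/le_trans + it]] := second_ge0 (1 + r / 2).
    + by rewrite -subr_eq0; lra.
    + by rewrite ltr0_norm; lra.
    by apply; apply: hm => //; nra.
  right => x x1; apply: generator_quadratic_ge => t /andP[t0 t1] it.
  by apply: hm => //; nra.
Qed.

End quadratic_bound.

(** * Sublevel sets of the conjugate and the height bound *)

Section height_for_width.
Context {R : realType}.

Lemma conjugate_leP (psi : R -> \bar R) y (h : \bar R) :
  (conjugate psi y <= h)%E <-> forall x, ((x * y)%:E - psi x <= h)%E.
Proof.
split=> [+ x|hx]; last by apply: ge_ereal_sup => _ [x _ <-].
by apply: le_trans; apply: ereal_sup_ubound; exists x.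
Qed.

(** For fixed [x], [x * y - psi x] is monotone in [y], in a direction given by the sign of [x], so
    one of the two endpoints dominates. This makes the sublevel sets measurable. *)
Lemma is_interval_conjugate_sublevel (psi : R -> \bar R) (h : \bar R) :
  is_interval [set y | (conjugate psi y <= h)%E].
Proof.
move=> y1 y2 /= /conjugate_leP h1 /conjugate_leP h2 y /andP[y1y yy2].
apply/conjugate_leP => x.
have [x0|x0] := leP 0 x.
  by apply: le_trans (h2 x); rewrite leeD2r// lee_fin ler_wpM2l.
by apply: le_trans (h1 x); rewrite leeD2r// lee_fin ler_wnM2l// ltW.
Qed.

(** The hypothesis is [conjugate psi <= h] on [[a, b]] with the terms rearranged, so the sublevel
    set at height [h] contains an interval of the required length. *)
Lemma hgt_conjugate_le (psi : R -> \bar R) (h a b : R) : a <= b -> 0 <= h ->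
  (forall x y, a <= y <= b -> ((x * y - h)%:E <= psi x)%E) ->
  (hgt (conjugate psi) (b - a) <= h%:E)%E.
Proof.
move=> ab h0 hpsi; apply: ereal_inf_lbound; split; first by rewrite lee_fin.
have -> : (b - a)%:E = lebesgue_measure `[a, b].
  rewrite lebesgue_measure_itv/= lte_fin.
  by case: ltgtP ab => // ->; rewrite subrr.
apply: le_measure; rewrite ?inE.
- exact: measurable_itv.
- apply: is_interval_measurable; exact: is_interval_conjugate_sublevel.
move=> y; rewrite /= in_itv/= => yab; apply/conjugate_leP => x.
have := hpsi x _ yab; case: (psi x) => [r||] //=; last by rewrite addeNy leNye.
by rewrite -EFinB !lee_fin; lra.
Qed.

End height_for_width.

Lemma hgt_generator_le {R : realType} (phi : R -> \bar R)
    (hphi : divergence_generator phi) (hdiff : twice_differentiable phi)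
    (hmono : monotone_second_derivative phi) (t : R) : 0 <= t ->
  0 < ederive phi 2 1 ->
  (hgt (conjugate (shift1 phi)) t <= (t ^+ 2 / (2 * ederive phi 2 1))%:E)%E.
Proof.
move=> t0 c0; set c := ederive phi 2 1.
have c0' : c != 0 by rewrite gt_eqF.
have h0 : 0 <= t ^+ 2 / (2 * c) by rewrite divr_ge0 ?sqr_ge0// mulr_ge0// ltW.
(* completing the square *)
have sq x y : `|y| <= t -> x * y - t ^+ 2 / (2 * c) <= c / 2 * x ^+ 2.
  move=> yt; rewrite lerBlDr -subr_ge0.
  have -> : c / 2 * x ^+ 2 + t ^+ 2 / (2 * c) - x * y =
      ((c * x - y) ^+ 2 + (t ^+ 2 - y ^+ 2)) / (2 * c) by field.
  apply: divr_ge0; last by rewrite mulr_ge0// ltW.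
  rewrite addr_ge0 ?sqr_ge0// subr_ge0.
  by rewrite -(real_normK (num_real y)) lerXn2r// nnegrE.
have phi0 x (a : R) : a <= 0 -> (a%:E <= shift1 phi x)%E.
  by move=> a0; apply: le_trans (generator_ge0 hphi _); rewrite lee_fin.
have [_ [hq|hq]] := generator_one_sided_quadratic phi hphi hdiff hmono.
(* The interval is [[0, t]] here and [[- t, 0]] below. Where [x * y <= 0], nonnegativity of [phi]
   suffices; elsewhere [x + 1] is on the good side of 1. *)
- rewrite -[X in hgt _ X]subr0; apply: hgt_conjugate_le => // x y /andP[y0 yt].
  have [x0|x0] := leP x 0; first by apply: phi0; nra.
  have := hq (x + 1); rewrite lerDr addrK => /(_ (ltW x0)); apply: le_trans.
  by rewrite lee_fin; apply: sq; rewrite ger0_norm.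
- rewrite -[X in hgt _ X]opprK -(sub0r (- t)).
  apply: hgt_conjugate_le; rewrite ?oppr_le0// => x y /andP[ty y0].
  have [x0|x0] := leP 0 x; first by apply: phi0; nra.
  have := hq (x + 1); rewrite gerDr addrK => /(_ (ltW x0)); apply: le_trans.
  by rewrite lee_fin; apply: sq; rewrite ler0_norm//; lra.
Qed.

(** * From pointwise minorants to lower bounds on the divergence *)

Local Open Scope ereal_scope.

Lemma slope_at_infty_ge0 {R : realType} (phi : R -> \bar R) :
  (forall x, 0 <= phi x) -> 0 <= slope_at_infty phi.
Proof.
move=> phi0; rewrite /slope_at_infty.
(* Without convergence [lim] is the default point of [\bar R], namely 0. *)
have [|/dvgP ->//] := pselect (cvg ((phi x * (x^-1)%:E) @[x --> +oo%R])).
move=> /lime_ge; apply; near=> x.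
by rewrite mule_ge0// lee_fin invr_ge0.
Unshelve. all: by end_near. Qed.

(** Eventually [c (x - 1)^2 / x >= c (x - 2)], which is unbounded. With the bound on the right of 1,
    any singular mass thus makes the divergence infinite. *)
Lemma slope_at_infty_quadratic {R : realType} (phi : R -> \bar R) (c : R) :
    (0 < c)%R -> (forall x, (1 <= x)%R -> (c * (x - 1) ^+ 2)%:E <= phi x) ->
  slope_at_infty phi = +oo.
Proof.
move=> c0 hphi; apply: cvg_lim => //; apply/cvgeyPge => A; near=> x.
have x1 : (1 <= x)%R by [].
have x0 : (0 < x)%R by exact: lt_le_trans x1.
apply: le_trans (lee_wpmul2r _ (hphi x x1)); last first.
  by rewrite lee_fin invr_ge0 ltW.
rewrite -EFinM lee_fin ler_pdivlMr//.
have Ax : (A / c + 2 <= x)%R by [].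
have -> : (c * (x - 1) ^+ 2 = c * (x - 2) * x + c)%R by ring.
have : (A <= c * (x - 2))%R by rewrite -ler_pdivrMl// mulrC lerBrDr.
by move=> Acx; rewrite ler_wpDr ?(ltW c0)// ler_wpM2r// ltW.
Unshelve. all: by end_near. Qed.

Section divergence_bound.
Context d (T : measurableType d) (R : realType).
Local Open Scope charge_scope.
Implicit Types (phi : R -> \bar R) (k g : T -> R).

Lemma bounded_integrable_finite (m : {finite_measure set T -> \bar R}) k :
  measurable_fun setT k -> (forall x, (`|k x| <= 1)%R) ->
  m.-integrable setT (EFin \o k).
Proof.
move=> mk k1; apply: measurable_bounded_integrable => //.
  by rewrite -ge0_fin_numE// fin_num_measure.
exists 1%R; split => // M M1 x _ /=; exact: le_trans (ltW M1).
Qed.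

(** The minorant is evaluated at [x = f t], with [f] the density of [muc], and integrated against
    [nu]; change of variables turns the integral of [k * f] into that of [k] against [muc]. *)
Lemma integral_generator_ge (muc : {finite_measure set T -> \bar R})
    (nu : probability T R) phi k (a C : R) :
    muc `<< nu -> (forall x, 0 <= phi x) -> measurable_fun setT phi ->
    measurable_fun setT k -> (forall x, (`|k x| <= 1)%R) ->
    (forall t x, (a * (k t * (x - 1)) - C)%:E <= phi x) ->
  a%:E * (\int[muc]_x (k x)%:E - \int[nu]_x (k x)%:E) - C%:E <=
  \int[nu]_x phi (fine ('d (charge_of_finite_measure muc) '/d nu x)).
Proof.
move=> numu phi0 mphi mk k1 hk.
set f := 'd (charge_of_finite_measure muc) '/d nu.
have ff x : f x \is a fin_num by exact: Radon_Nikodym_fin_num.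
have if_ : nu.-integrable setT f by exact: Radon_Nikodym_integrable.
have mf : measurable_fun setT (fine \o f).
  by apply: measurableT_comp => //; exact: measurable_int if_.
have mphif : measurable_fun setT (phi \o (fine \o f)).
  exact: measurableT_comp.
(* Once the infinite case is set aside, [phi \o f] is integrable and integrals can be compared. *)
have [/eqP ->|phioo] := boolP (\int[nu]_x phi (fine (f x)) == +oo).
  exact: leey.
have iphif : nu.-integrable setT (phi \o (fine \o f)).
  apply/integrableP; split => //.
  under eq_integral do rewrite /= gee0_abs//.
  by rewrite ltey.
have ik : nu.-integrable setT (EFin \o k) by exact: bounded_integrable_finite.
have ikf : nu.-integrable setT (fun x => (k x)%:E * f x).
  apply: (integrableMr _ mk _ if_) => //.
  exists 1%R; split => // M M1 x _ /=; exact: le_trans (ltW M1).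
have iC : nu.-integrable setT (EFin \o cst C).
  exact: finite_measure_integrable_cst.
rewrite -(Radon_Nikodym_change_of_variables numu)//; last first.
  exact: bounded_integrable_finite.
rewrite -integralB// -integralZl//; last exact: integrableB.
have -> : C%:E = \int[nu]_x (cst C x)%:E.
  rewrite lebesgue_integral_nonneg.integral_cstr//.
  by rewrite [X in _ = _ * X]probability_setT mule1.
rewrite -integralB//; last first.
  by apply: integrableZl => //; exact: integrableB.
apply: le_integral => //.
  by apply: integrableB => //; apply: integrableZl => //; exact: integrableB.
move=> x _ /=; apply: le_trans (hk x _).
have -> : 'd (charge_of_finite_measure muc) '/d nu x = (fine (f x))%:E.
  by rewrite fineK.
rewrite -[leLHS]/((a * (k x * fine (f x) - k x) - C)%:E) lee_fin.
by rewrite (mulrBr (k x)) mulr1.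
Qed.


Lemma phi_divergence_ge0 phi (mu nu : probability T R) :
  (forall x, 0 <= phi x) -> 0 <= phi_divergence phi mu nu.
Proof.
move=> phi0; rewrite /phi_divergence; case: lebesgue_decomposition => muc mus.
rewrite adde_ge0 ?integral_ge0// mule_ge0//; exact: slope_at_infty_ge0.
Qed.

(** The last hypothesis controls the singular part: either [k <= 0] makes its contribution to the
    left side nonpositive, or the infinite slope leaves only [mus = 0] or an infinite divergence. *)
Lemma phi_divergence_ge phi (mu nu : probability T R) k (a C : R) :
    (forall x, 0 <= phi x) -> measurable_fun setT phi ->
    measurable_fun setT k -> (forall x, (`|k x| <= 1)%R) -> (0 <= a)%R ->
    (forall t x, (a * (k t * (x - 1)) - C)%:E <= phi x) ->
    (forall t, k t <= 0)%R \/ slope_at_infty phi = +oo ->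
  a%:E * (\int[mu]_x (k x)%:E - \int[nu]_x (k x)%:E) - C%:E <=
  phi_divergence phi mu nu.
Proof.
move=> phi0 mphi mk k1 a0 hk hs; rewrite /phi_divergence.
have slope0 := slope_at_infty_ge0 phi phi0.
rewrite /lebesgue_decomposition; case: cid => -[muc mus] [/= muE muc_nu _].
have main := integral_generator_ge muc nu _ _ _ _ muc_nu phi0 mphi mk k1 hk.
have ik m := bounded_integrable_finite m _ mk k1.
have muI : \int[mu]_x (k x)%:E = \int[muc]_x (k x)%:E + \int[mus]_x (k x)%:E.
  rewrite -integral_measure_add//; [|exact: ik..].
  apply: (eq_measure_integral (measure_add muc mus)) => A mA _.
  by rewrite /measure_add/= /msum !big_ord_recl big_ord0 adde0 muE.
have [mus0|mus0] := eqVneq (mus setT * slope_at_infty phi) +oo.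
  rewrite [X in _ <= _ + X]mus0 addey ?leey// gt_eqF//.
  by apply: lt_le_trans (integral_ge0 _ _) => //=; rewrite ltNy0.
have musk : \int[mus]_x (k x)%:E <= 0.
  have [k0|soo] := hs.
    rewrite -(integral0 mus setT); apply: le_integral => //.
    + exact: ik.
    + exact: integrable0.
    by move=> x _; rewrite lee_fin.
  rewrite null_set_integral//; first exact/measurable_EFinP.
  apply/eqP; apply: contra_neqT mus0 => musT; rewrite soo gt0_muley//.
  by rewrite lt0e musT measure_ge0.
apply: le_trans (leeDl _ _); last by rewrite mule_ge0.
apply: le_trans main; rewrite leeD2r// lee_wpmul2l ?lee_fin// leeD2r//.
by rewrite muI geeDl.
Qed.

Lemma integral_affine (m : probability T R) g (a b : R) :
    m.-integrable setT (EFin \o g) ->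
  \int[m]_x (a * g x + b)%:E = a%:E * \int[m]_x (g x)%:E + b%:E.
Proof.
move=> ig; have ib : m.-integrable setT (EFin \o cst b).
  exact: finite_measure_integrable_cst.
under eq_integral do rewrite EFinD EFinM.
rewrite integralD//; last exact: integrableZl.
rewrite integralZl//; congr (_ + _).
rewrite lebesgue_integral_nonneg.integral_cstr//.
by rewrite [X in _ * X = _]probability_setT mule1.
Qed.

(* The test function [(g + s) / 2], with [s = 1] or [s = -1] according to the
   side of [1] on which [phi] is quadratically bounded below, takes values on
   that side only; its coefficient [e / 2] is the one that optimizes
   [c (a k (x - 1) - a^2 / 2) <= c / 2 (x - 1)^2]. *)
Lemma phi_divergence_ge_sqr phi (mu nu : probability T R) g :
    divergence_generator phi -> twice_differentiable phi ->
    monotone_second_derivative phi ->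
    measurable_fun setT g -> (forall x, (-1 <= g x <= 1)%R) ->
  (ederive phi 2 1 / 8)%:E * (\int[mu]_x (g x)%:E - \int[nu]_x (g x)%:E) ^+ 2
    <= phi_divergence phi mu nu.
Proof.
move=> hphi hdiff hmono.
have phi0 := generator_ge0 hphi.
have mphi := lower_semicontinuous_measurable (generator_lsc hphi).
have [] := generator_one_sided_quadratic phi hphi hdiff hmono.
set c := ederive phi 2 1 => c0 hq.
have [c_eq0 _ _|c_neq0] := eqVneq c 0%R.
  by rewrite c_eq0 mul0r mul0e; exact: phi_divergence_ge0.
have {c_neq0}c_gt0 : (0 < c)%R by rewrite lt0r c_neq0.
pose I (m : probability T R) (h : T -> R) : \bar R := \int[m]_x (h x)%:E.
have ig (m : probability T R) (h : T -> R) : measurable_fun setT h ->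
    (forall x, (-1 <= h x <= 1)%R) -> m.-integrable setT (EFin \o h).
  by move=> mh h1; apply: bounded_integrable_finite => // x; rewrite ler_norml.
move=> mg g1; have fI m : I m g \is a fin_num.
  by apply: integrable_fin_num => //; exact: ig.
rewrite -/(I mu g) -/(I nu g).
(* Negating [g] flips the sign of the difference and keeps its square; [g'] has an affine form so
   that [integral_affine] applies. *)
wlog e0 : g mg g1 fI / 0 <= I mu g - I nu g.
  move=> wl; have [|lt0] := leP 0 (I mu g - I nu g); first exact: wl.
  pose g' x := (- 1 * g x + 0)%R.
  have Ig' m : I m g' = (- fine (I m g))%:E.
    rewrite /I integral_affine ?ig// -/(I m g) -(fineK (fI m)).
    by rewrite -EFinM adde0 mulN1r.
  have -> : (I mu g - I nu g) ^+ 2 = (I mu g' - I nu g') ^+ 2.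
    rewrite !Ig' -(fineK (fI mu)) -(fineK (fI nu)) -!EFinB -!EFin_expe.
    by congr EFin; rewrite /=; ring.
  apply: wl.
  - by apply: measurable_funD => //; exact: measurable_funM.
  - by move=> x; have /andP[? ?] := g1 x; rewrite /g'; apply/andP; split; lra.
  - by move=> m; rewrite Ig'.
  - move: lt0; rewrite !Ig' -(fineK (fI mu)) -(fineK (fI nu)) -!EFinB.
    by rewrite lee_fin lte_fin/=; lra.
pose e : R := (fine (I mu g) - fine (I nu g))%R.
have eE : I mu g - I nu g = e%:E by rewrite EFinB !fineK.
rewrite eE -EFin_expe -EFinM.
move: e0; rewrite eE lee_fin => e0.
have [s [s1 hs hslope]] : exists s : R, [/\ (s ^+ 2 = 1)%R,
    (forall x, (0 <= s * (x - 1))%R -> (c / 2 * (x - 1) ^+ 2)%:E <= phi x) &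
    (s = -1)%R \/ slope_at_infty phi = +oo].
  case: hq => hq.
  - exists 1%R; rewrite expr1n; split=> // [x|].
      by rewrite mul1r subr_ge0; exact: hq.
    by right; apply: slope_at_infty_quadratic hq; rewrite divr_gt0.
  - exists (-1)%R; rewrite sqrrN expr1n; split=> // [x|]; last by left.
    by rewrite mulN1r oppr_ge0 subr_le0; exact: hq.
pose k x : R := (2^-1 * g x + s / 2)%R.
have sP : s = 1%R \/ s = (-1)%R.
  by move/eqP: s1; rewrite sqrf_eq1 => /orP[]/eqP ->; [left|right].
have Ik m : I m k = (2^-1 * fine (I m g) + s / 2)%:E.
  by rewrite /I integral_affine ?ig// -/(I m g) -{1}(fineK (fI m)).
(* The constant [s / 2] cancels between two probabilities, so the integrals of [k] differ by [e / 2]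
   and the right side is [c e^2 / 4 - c e^2 / 8]. *)
have -> : (c / 8 * e ^+ 2)%:E =
    (c * (e / 2))%:E * (I mu k - I nu k) - (c * (e / 2) ^+ 2 / 2)%:E.
  have -> : I mu k - I nu k = (e / 2)%:E.
    by rewrite !Ik -EFinB /e; congr EFin; lra.
  rewrite -EFinM -EFinB; by congr EFin; field.
apply: phi_divergence_ge => //.
- by apply: measurable_funD => //; exact: measurable_funM.
- move=> x; rewrite /k ler_norml; have /andP[? ?] := g1 x.
  by apply/andP; case: sP => ->; split; lra.
- by rewrite mulr_ge0// divr_ge0.
- move=> t x; set v := (s * (x - 1))%R.
  (* [k t * (x - 1)] is [v] times a weight in [0, 1] *)
  have kv : (k t * (x - 1) <= Num.max 0 v)%R.
    have -> : (k t * (x - 1) = (2^-1 * (s * g t) + 2^-1) * v)%R.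
      rewrite /k /v.
      have -> : ((2^-1 * (s * g t) + 2^-1) * (s * (x - 1)) =
        (s ^+ 2 * g t / 2 + s / 2) * (x - 1))%R by ring.
      by rewrite s1; ring.
    have /andP[? ?] := g1 t.
    by rewrite le_max; case: (leP 0%R v) => v0; apply/orP; [right|left];
      case: sP => ->; nra.
  (* On the good side the gap is at least [c / 2 (v - e / 2)^2]; on the other the affine minorant is
     nonpositive. *)
  have [sx|sx] := leP 0%R v.
    apply: le_trans (hs x sx); rewrite lee_fin.
    have -> : ((x - 1) ^+ 2 = v ^+ 2)%R by rewrite /v exprMn s1 mul1r.
    rewrite (max_r sx) in kv.
    have : (0 <= c / 2 * (v - e / 2) ^+ 2)%R.
      by rewrite mulr_ge0 ?sqr_ge0// divr_ge0// ltW.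
    have : (c * (e / 2) * (k t * (x - 1)) <= c * (e / 2) * v)%R.
      by rewrite ler_wpM2l// mulr_ge0// divr_ge0.
    by lra.
  apply: le_trans (phi0 x); rewrite lee_fin.
  rewrite (max_l (ltW sx)) in kv.
  have : (0 <= c * (e / 2) ^+ 2 / 2)%R by rewrite divr_ge0// mulr_ge0// sqr_ge0.
  have : (c * (e / 2) * (k t * (x - 1)) <= 0)%R.
    by rewrite mulr_ge0_le0// mulr_ge0// divr_ge0.
  by lra.
- case: hslope => [sN|]; last by right.
  by left=> t; rewrite /k sN; have /andP[? ?] := g1 t; lra.
Qed.

End divergence_bound.

(** * Supremum over test functions and conclusion *)

(** For [c > 0] and [D = r] finite, each element is at most [sqrt (r / c)], and so is the supremum.
    Nonemptiness matters: the empty supremum [-oo] has square [+oo]. *)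
Lemma mule_ereal_sup_sqr_le {R : realType} (S : set (\bar R)) (c : R)
    (D : \bar R) : (0 <= c)%R -> 0 <= D -> S !=set0 ->
    (forall x, S x -> 0 <= x /\ c%:E * x ^+ 2 <= D) ->
  c%:E * ereal_sup S ^+ 2 <= D.
Proof.
move=> c0 D0 [x0 Sx0] hS.
have [->|c_neq0] := eqVneq c 0%R; first by rewrite mul0e.
have c_gt0 : (0 < c)%R by rewrite lt0r c_neq0.
case: D D0 hS => [r r0 hS|_ _|//]; last exact: leey.
have S0 : 0 <= ereal_sup S.
  by apply: le_trans (hS _ Sx0).1 _; exact: ereal_sup_ubound.
have SR : ereal_sup S <= (Num.sqrt (r / c))%:E.
  apply: ge_ereal_sup => x /hS[]; case: x => [x||//].
    rewrite -EFin_expe -EFinM !lee_fin => x_ge0 cx.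
    by rewrite -(ger0_norm x_ge0) -sqrtr_sqr ler_wsqrtr// ler_pdivlMr// mulrC.
  by move=> _; rewrite expe2 mulyy gt0_muley ?lte_fin.
set q := Num.sqrt _ in SR.
rewrite expe2; apply: (@le_trans _ _ (c%:E * (q%:E * q%:E))).
  by rewrite lee_wpmul2l// lee_pmul.
rewrite -!EFinM lee_fin -expr2 /q sqr_sqrtr ?divr_ge0//.
by rewrite mulrC divfK.
Qed.

Theorem corollary6p3p11 (R : realType) (d : measure_display)
    (T : measurableType d) (hT : nontrivial_measurable T)
    (phi : R -> \bar R) (hphi : divergence_generator phi)
    (hdiff : twice_differentiable phi)
    (hmono : monotone_second_derivative phi) :
  (forall t : R, (0 <= t)%R ->
     hgt (conjugate (shift1 phi)) t <=
       (if ederive phi 2 1 == 0%R then +oo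
        else (t ^+ 2 / (2 * ederive phi 2 1))%:E)) /\
  (forall mu nu : probability T R,
     (ederive phi 2 1 / 8)%:E * TV mu nu ^+ 2 <= phi_divergence phi mu nu).
Proof.
have [c0 _] := generator_one_sided_quadratic phi hphi hdiff hmono.
(* The two claims are derived separately from the quadratic bound, neither from the other. *)
split=> [t t0|mu nu].
  have [_|c_neq0] := eqVneq; first exact: leey.
  by apply: hgt_generator_le => //; rewrite lt0r c_neq0.
apply: mule_ereal_sup_sqr_le; first by rewrite divr_ge0.
- exact: phi_divergence_ge0 (generator_ge0 hphi).
- by eexists; exists (cst 0%R) => //; split => // x; rewrite /= lerN10 ler01.
move=> _ [g [mg g1] <-]; split=> //.
rewrite (_ : `|_| ^+ 2 = (\int[mu]_x (g x)%:E - \int[nu]_x (g x)%:E) ^+ 2).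
  exact: phi_divergence_ge_sqr.
by rewrite !expe2 -abseM gee0_abs// -expe2 sqre_ge0.
Qed.
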